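(* The following hold. (i) For all $n\ge3$, $$[1a]_n(1,t)=t^2(t+1)^{n-2}-t^n.$$ (ii) For all $n\ge3$ and all $k\ge2$, $$[k*]_n(1,t)=\begin{cases} t^2(t+1)^{n-k-1}-t^{n-k+1}+t^{n-k} & \text{if } k<n;\\ 0 & \text{if } k\ge n.\end{cases}$$ (iii) For all $n\ge1$, the generating function for $F_n(321,2143)$ with respect to left-to-right maxima is $$T_n(1,t)=t(t+1)^{n-1}.$$
   Context: A Fishburn permutation is a permutation $\pi$ (in one-line notation) with no subsequence $\pi_j,\pi_{j+1},\pi_k$ such that $j+1<k$, $\pi_j=\pi_k+1$, and $\pi_{j+1}>\pi_j$. $F_n(321,2143)$ is the set of Fishburn permutations of length $n$ avoiding the classical patterns $321$ and $2143$. $\operatorname{inv}(\pi)$ is the number of inversions and $\operatorname{lrmax}(\pi)$ the number of left-to-right maxima (entries greater than all entries to their left). A descent is a pair of adjacent entries $\pi_j>\pi_{j+1}$. Labels (for $n\ge3$): $\pi\in F_n(321,2143)$ has label (1a) if $\pi_n=n$ and $\pi$ has a descent. For $k\ge1$, $\pi$ has label (k* ) if either the rightmost $k+1$ entries of $\pi$ are $n,n-k,n-k+1,\ldots,n-2,n-1$, or $k\ge2$ and the rightmost $k$ entries of $\pi$ are $n,\ell-k+2,\ell-k+3,\ldots,\ell-1,\ell$ for some $\ell$ with $k-1<\ell<n-1$. For a label $(y)$, $[y]_n(q,t)=\sum q^{\operatorname{inv}(\pi)}t^{\operatorname{lrmax}(\pi)}$, summed over the $\pi\in F_n(321,2143)$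 with label $(y)$, and $T_n(q,t)=\sum_{\pi\in F_n(321,2143)}q^{\operatorname{inv}(\pi)}t^{\operatorname{lrmax}(\pi)}$. $[y]_n(1,t)$ and $T_n(1,t)$ are obtained by setting $q=1$. *)

(* Defs.v *)
From HB Require Import structures.
From mathcomp Require Import all_boot all_order all_fingroup all_algebra.

Set Implicit Arguments.
Unset Strict Implicit.
Unset Printing Implicit Defensive.

Import GRing.Theory.

Local Open Scope ring_scope.

(* A permutation of {1, ..., n} is an element of 'S_n, whose positions and     *)
(* entries are numbered from 0; only [oneline] restores the entries 1, ..., n. *)
Definition oneline (n : nat) (s : 'S_n) : seq nat :=
  [seq (s i).+1 | i <- enum 'I_n].

(* The pattern p is given in one-line notation. *)
Definition contains (p : seq nat) (n : nat) (s : 'S_n) : bool :=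
  [exists f : {ffun 'I_(size p) -> 'I_n},
   forall i : 'I_(size p), forall j : 'I_(size p),
    ((i < j)%N ==> (f i < f j)%N) &&
    ((nth 0%N p i < nth 0%N p j)%N == (s (f i) < s (f j))%N)].

Definition avoids (p : seq nat) (n : nat) (s : 'S_n) : bool := ~~ contains p s.

Definition fishburn (n : nat) (s : 'S_n) : bool :=
  ~~ [exists j : 'I_n, exists j1 : 'I_n, exists k : 'I_n,
      [&& j1 == j.+1 :> nat, (j1 < k)%N,
          s j == (s k).+1 :> nat & (s j < s j1)%N]].

Definition F (n : nat) : {set 'S_n} :=
  [set s : 'S_n | [&& fishburn s, avoids [:: 3; 2; 1]%N s
                    & avoids [:: 2; 1; 4; 3]%N s]].

Definition inv (n : nat) (s : 'S_n) : nat :=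
  #|[set ij : 'I_n * 'I_n | (ij.1 < ij.2)%N && (s ij.2 < s ij.1)%N]|.

Definition lrmax (n : nat) (s : 'S_n) : nat :=
  #|[set i : 'I_n | [forall j : 'I_n, (j < i)%N ==> (s j < s i)%N]]|.

Definition has_descent (n : nat) (s : 'S_n) : bool :=
  [exists i : 'I_n, exists j : 'I_n, (j == i.+1 :> nat) && (s j < s i)%N].

Definition label_1a (n : nat) (s : 'S_n) : bool :=
  (last 0%N (oneline s) == n) && has_descent s.

(* Since [oneline s] has size n, each equation forces the suffix to have the   *)
(* stated length, hence k + 1 <= n, resp. k <= n. In the second one k <= l, so *)
(* the entries (l - k).+2, ..., l involve no truncated subtraction.            *)
Definition label_star (k : nat) (n : nat) (s : 'S_n) : bool :=
  (0 < k)%N &&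
  ((drop (n - k.+1) (oneline s) == n :: iota (n - k) k) ||
   ((2 <= k)%N &&
    [exists l : 'I_n, [&& (k - 1 < l)%N, (l < n - 1)%N &
       drop (n - k) (oneline s) == n :: iota (l - k).+2 (k - 1)]])).

(* Polynomials in q and t are encoded in Z[t][q]: the outer variable is q and  *)
(* the inner one is t, so that evaluation at 1 sets q = 1 and leaves a         *)
(* polynomial in t.                                                            *)
Definition label_gf (n : nat) (y : pred 'S_n) : {poly {poly int}} :=
  \sum_(s in F n | y s) 'X^(inv s) * ('X^(lrmax s))%:P.

Definition T (n : nat) : {poly {poly int}} :=
  \sum_(s in F n) 'X^(inv s) * ('X^(lrmax s))%:P.

(* Main.v *)
(* Fishburn permutations avoiding 321 and 2143 have at most one descent in their
   inverse, so they are shuffles of 1 ... m and m + 1 ... n, determined by the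
   word recording which positions carry small and which carry large entries. The
   Fishburn condition then says that the first large entry is followed by a
   small one: apart from the identity, the words are S^a L S w with w arbitrary.
   The left-to-right maxima are the first a entries and all large ones, which
   gives T_n = t T_(n-1) + t (t + 1)^(n-2). The labels prescribe suffixes of w,
   and their generating functions satisfy recurrences of the same kind. *)

Require Import Defs.
From HB Require Import structures.
From mathcomp Require Import all_boot all_order all_fingroup all_algebra.
From mathcomp Require Import zify ring.

Set Implicit Arguments.
Unset Strict Implicit.
Unset Printing Implicit Defensive.

Import GRing.Theory.

Local Open Scope nat_scope.

(** * Binary words, Fishburn words and their statistic *)

Fixpoint words (n : nat) : seq (seq bool) :=
  if n is m.+1
  then map (cons false) (words m) ++ map (cons true) (words m)
  else [:: [::]].

(* [false] stands for a small entry and [true] for a large one: the first large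
   entry, if any, has to be followed by a small one. *)
Fixpoint fishburn_word (u : seq bool) : bool :=
  if u is b :: u' then if b then ~~ head true u' else fishburn_word u'
  else true.

(** Before the first large letter every entry is a left-to-right maximum; from there on exactly the
    large ones are. *)
Fixpoint word_lrmax (u : seq bool) : nat :=
  if u is b :: u' then (if b then count id u' else word_lrmax u').+1 else 0.

Lemma mem_words (n : nat) (u : seq bool) : (u \in words n) = (size u == n).
Proof.
elim: n u => [|n IH] [|b u] //=; rewrite mem_cat.
  by apply/orP => -[] /mapP[].
rewrite eqSS -IH; apply/orP/idP => [[] /mapP[v vP [_ ->]] // | uP].
by case: b; [right | left]; apply: map_f.
Qed.

Lemma words_uniq (n : nat) : uniq (words n).
Proof.
elim: n => [|n IH] //=; rewrite cat_uniq !map_inj_uniq ?IH /= ?andbT;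
  try by move=> ? ? [].
by apply/hasPn => _ /mapP[u _ ->]; apply/mapP => -[].
Qed.

Lemma suffix_cons_eq (T : eqType) (v u : seq T) (x : T) :
  suffix v (x :: u) = (v == x :: u) || suffix v u.
Proof.
rewrite !suffixE; have [le_vu | lt_uv] := leqP (size v) (size u).
  rewrite /= subSn //= orbC; case: eqP => //= _; apply/esym/eqP => v_eq.
  by move: le_vu; rewrite v_eq /= ltnn.
have -> : size u - size v = 0 by apply/eqP; rewrite subn_eq0 ltnW.
have -> : size (x :: u) - size v = 0 by apply/eqP; rewrite subn_eq0.
rewrite !drop0 eq_sym [u == v]eq_sym; case: (v =P u) => [v_eq|]; last first.
  by rewrite orbF.
by move: lt_uv; rewrite v_eq ltnn.
Qed.

(** * Recurrences for sums over words *)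

Local Open Scope ring_scope.

Lemma big_words (R : nmodType) (n : nat) (P : pred (seq bool))
    (f : seq bool -> R) :
  \sum_(u <- words n.+1 | P u) f u =
  \sum_(u <- words n | P (false :: u)) f (false :: u) +
  \sum_(u <- words n | P (true :: u)) f (true :: u).
Proof. by rewrite big_cat !big_map. Qed.

(** The [p] letters before [v] are free, and each contributes a factor [x + 1]. *)
Lemma sum_words_suffix (R : comNzRingType) (x : R) (p : nat) (v : seq bool) :
  \sum_(w <- words (p + size v) | suffix v w) x ^+ count id w =
  x ^+ count id v * (x + 1) ^+ p.
Proof.
elim: p => [|p IH].
  rewrite add0n mulr1 big_seq_cond.
  rewrite (eq_bigl (fun w => (w \in words (size v)) && (w == v))) => [|w].
    rewrite -big_seq_cond -big_filter filter_pred1_uniq ?words_uniq //.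
      by rewrite big_seq1.
    by rewrite mem_words.
  rewrite mem_words; case: eqP => //= size_w.
  by rewrite suffixE size_w subnn drop0.
rewrite addSn big_words.
have E b : \sum_(w <- words (p + size v) | suffix v (b :: w))
      x ^+ count id (b :: w) = x ^+ b * (x ^+ count id v * (x + 1) ^+ p).
  rewrite -IH mulr_sumr big_seq_cond [RHS]big_seq_cond.
  apply: eq_big => [w|w _]; last by rewrite /= exprD.
  rewrite mem_words; case: eqP => //= size_w; rewrite suffix_cons_eq.
  case: eqP => // v_eq.
  by move: size_w; rewrite v_eq /=; lia.
by rewrite !E exprS; ring.
Qed.

(** A Fishburn word of length at least 2 is either [false] followed by a Fishburn word, or [true],
    [false] followed by arbitrary letters, of which only the large ones still count. *)
Lemma sum_fishburn_words (R : comNzRingType) (x : R) (n : nat)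
    (P : pred (seq bool)) :
  \sum_(u <- words n.+2 | fishburn_word u && P u) x ^+ word_lrmax u =
  x * \sum_(u <- words n.+1 | fishburn_word u && P (false :: u))
        x ^+ word_lrmax u +
  x * \sum_(w <- words n | P [:: true, false & w]) x ^+ count id w.
Proof.
rewrite big_words; congr (_ + _).
  by rewrite mulr_sumr; apply: eq_bigr => u _; rewrite -exprS.
rewrite big_words [X in _ + X]big1 ?addr0 => [|u //].
by rewrite mulr_sumr; apply: eq_bigr => u _; rewrite -exprS.
Qed.

(** The descent in label (1a) is implicit: in a Fishburn word the first large letter is followed by
    a small one. *)
Definition word_1a : pred (seq bool) := suffix [:: true].

Definition word_star (k : nat) : pred (seq bool) := fun u =>
  (suffix (true :: nseq k false) u && (count id u == 1%N)) ||
  (suffix (true :: nseq k.-1 false) u && (1 < count id u)%N).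

Lemma sum_word_all (R : comNzRingType) (x : R) (n : nat) :
  \sum_(u <- words n.+1 | fishburn_word u) x ^+ word_lrmax u =
  x * (x + 1) ^+ n.
Proof.
elim: n => [|n IH].
  by rewrite unlock /= addr0 mulr1.
rewrite (eq_bigl (fun u => fishburn_word u && xpredT u)) => [|u]; last first.
  by rewrite andbT.
rewrite sum_fishburn_words (eq_bigl fishburn_word) => [|u]; last first.
  by rewrite andbT.
rewrite IH (eq_bigl (suffix [::])) => [|w]; last by rewrite suffix0s.
have := sum_words_suffix x n [::]; rewrite addn0 => ->.
by rewrite exprS /=; ring.
Qed.

Lemma sum_word_1a (R : comNzRingType) (x : R) (n : nat) :
  \sum_(u <- words n.+2 | fishburn_word u && word_1a u) x ^+ word_lrmax u =
  x ^+ 2 * (x + 1) ^+ n - x ^+ n.+2.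
Proof.
elim: n => [|n IH].
  (* Both Fishburn words of length 2 end in [false], and the right-hand side vanishes. *)
  by rewrite big_mkcond unlock /= addr0 mulr1 subrr !addr0.
rewrite sum_fishburn_words.
rewrite (eq_bigl (fun u => fishburn_word u && word_1a u)) => [|u].
  rewrite IH (eq_bigl (suffix [:: true])) => [|w].
    have := sum_words_suffix x n [:: true]; rewrite addn1 => -> /=.
    by rewrite !exprS; ring.
  by rewrite /word_1a !suffix_cons_eq.
by rewrite /word_1a !suffix_cons_eq.
Qed.

Local Open Scope nat_scope.

Lemma word_star_false (k : nat) (u : seq bool) :
  word_star k (false :: u) = word_star k u.
Proof. by rewrite /word_star !suffix_cons_eq. Qed.

(** If [w] has no large letter, the count leaves only the first case of [word_star]. Otherwise there
    are at least two large letters, so only the second case remains, and its suffix lies inside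
    [w]. *)
Lemma word_star_true_false (k : nat) (w : seq bool) :
  word_star k.+1 [:: true, false & w] =
  (w == nseq k false) || suffix (true :: nseq k false) w.
Proof.
have suffix_count j : suffix (true :: nseq j false) w -> 0 < count id w.
  by case/suffixP => w1 ->; rewrite count_cat /= !addnS.
have count_nseqF j : count id (nseq j false) = 0 by rewrite count_nseq.
rewrite /word_star !suffix_cons_eq !eqseq_cons /= add1n eqSS ltnS.
rewrite [nseq k false == w]eq_sym.
case: (w =P _) => [->|w_neq]; first by rewrite count_nseqF.
case: (nseq k false =P false :: w) => [k_eq|_] /=.
  have w0 : count id w = 0 by rewrite -(count_nseqF k) k_eq.
  have suffixF j : suffix (true :: nseq j false) w = false.
    by apply/negP => /suffix_count; rewrite w0.
  by rewrite (suffixF k) (suffixF k.+1) w0.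
case E1: (suffix [:: true, false & nseq k false] w).
  have E2 := suffix_count k.+1 E1.
  by rewrite add0n E2 andbT eqn0Ngt E2.
by case E2: (suffix _ w) => //=; rewrite add0n (suffix_count k).
Qed.

Lemma word_star_size (k : nat) (u : seq bool) :
  0 < k -> word_star k u -> k < size u.
Proof.
case: k => // k _ /orP[] /andP[/suffixP[v ->]]; rewrite size_cat /= size_nseq.
  by rewrite addnS ltnS leq_addl.
(* The suffix of the second case holds a single large letter, so the count forces a nonempty
   prefix. *)
rewrite count_cat /= count_nseq addn0 addn1 ltnS addnS ltnS.
by case: v => //= b v _; rewrite addSn ltnS leq_addl.
Qed.

Local Open Scope ring_scope.

Lemma sum_word_star_small (R : comNzRingType) (x : R) (k n : nat) :
  (0 < k)%N -> (n <= k)%N ->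
  \sum_(u <- words n | fishburn_word u && word_star k u) x ^+ word_lrmax u = 0.
Proof.
move=> k_gt0 le_nk; rewrite big_seq_cond big_pred0 // => u; rewrite mem_words.
apply/and3P => -[/eqP size_u _ /(word_star_size k_gt0)].
by rewrite size_u ltnNge le_nk.
Qed.

Lemma sum_word_star (R : comNzRingType) (x : R) (k p : nat) :
  \sum_(u <- words (p + k.+2).+1 | fishburn_word u && word_star k.+2 u)
     x ^+ word_lrmax u =
  x ^+ 2 * (x + 1) ^+ p - x ^+ p.+2 + x ^+ p.+1.
Proof.
have star_false n :
    \sum_(u <- words n | fishburn_word u && word_star k.+2 (false :: u))
      x ^+ word_lrmax u =
    \sum_(u <- words n | fishburn_word u && word_star k.+2 u)
      x ^+ word_lrmax u.
  by apply: eq_bigl => u; rewrite word_star_false.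
elim: p => [|p IH].
  (* For [p = 0], removing an initial [false] leaves a word too short for the label; the only word
     is [true] followed by [k.+2] letters [false]. *)
  rewrite add0n sum_fishburn_words star_false sum_word_star_small //.
  rewrite (eq_bigl (fun w => word_star k.+2 [:: true, false & w])) //.
  rewrite big_seq_cond (eq_bigl (fun w => (w \in words k.+1)
    && (w == nseq k.+1 false))) => [|w].
    rewrite -big_seq_cond -big_filter filter_pred1_uniq ?words_uniq //.
      by rewrite big_seq1 count_nseq /=; ring.
    by rewrite mem_words size_nseq.
  rewrite word_star_true_false mem_words; case: eqP => //= size_w.
  case: eqP => //= _; apply/negP => /size_suffix.
  by rewrite size_w /= size_nseq ltnn.
rewrite addSn sum_fishburn_words star_false IH.
(* Here [w] is too long to be [nseq k.+1 false], so it must end in [true :: nseq k.+1 false]. *)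
have -> : \sum_(w <- words (p + k.+2) | word_star k.+2 [:: true, false & w])
    x ^+ count id w = x * (x + 1) ^+ p.
  have := sum_words_suffix x p (true :: nseq k.+1 false).
  rewrite /= size_nseq count_nseq /= expr1 => <-.
  rewrite big_seq_cond [RHS]big_seq_cond; apply: eq_bigl => w.
  rewrite word_star_true_false mem_words; case: eqP => //= size_w.
  case: eqP => // w_eq; move: size_w; rewrite w_eq /= size_nseq; lia.
by rewrite !exprS; ring.
Qed.

(** * The permutation of a word *)

Local Open Scope nat_scope.

Lemma count_take_lt (T : Type) (x0 : T) (a : pred T) (u : seq T) (i j : nat) :
  i < j -> i < size u -> a (nth x0 u i) ->
  count a (take i u) < count a (take j u).
Proof.
move=> lt_ij lt_iu ai.
have -> : take i u = take i (take j u) by rewrite take_takel // ltnW.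
rewrite -[X in _ < count a X](cat_take_drop i) count_cat -addn1 leq_add2l.
rewrite (drop_nth x0) ?size_take; last by case: ifP.
by rewrite nth_take //= ai.
Qed.

(* One-line notation, from 0, of the permutation in which the entries below
   [count negb u] occur in increasing order at the letters [false] of [u], and
   the other ones in increasing order at the letters [true]. *)
Definition shuffle (u : seq bool) (i : nat) : nat :=
  if nth false u i then count negb u + count id (take i u)
  else count negb (take i u).

Lemma count_negb_id (u : seq bool) : count negb u + count id u = size u.
Proof. by elim: u => //= -[] u /=; lia. Qed.

Lemma shuffle_small (u : seq bool) (i : nat) :
  i < size u -> nth false u i = false -> shuffle u i < count negb u.
Proof.
move=> lt_iu ui; rewrite /shuffle ui -[X in _ < count _ X]take_size.
by apply: (count_take_lt (x0 := false)); rewrite ?ui.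
Qed.

Lemma shuffle_large (u : seq bool) (i : nat) :
  nth false u i -> count negb u <= shuffle u i.
Proof. by move=> ui; rewrite /shuffle ui leq_addr. Qed.

Lemma shuffle_bound (u : seq bool) (i : nat) :
  i < size u -> shuffle u i < size u.
Proof.
move=> lt_iu; case ui: (nth false u i); last first.
  by apply: leq_trans (shuffle_small lt_iu ui) _; apply: count_size.
rewrite /shuffle ui -(count_negb_id u) ltn_add2l.
rewrite -[X in _ < count _ X]take_size.
by apply: (count_take_lt (x0 := false)); rewrite ?ui.
Qed.

(** With [shuffle_gt], this turns order conditions on entries into conditions on letters: the
    inversions are the pairs with a large letter before a small one. *)
Lemma shuffle_lt (u : seq bool) (i j : nat) : i < j -> j < size u ->
  (shuffle u i < shuffle u j) = (nth false u i ==> nth false u j).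
Proof.
move=> lt_ij lt_ju; have lt_iu := ltn_trans lt_ij lt_ju.
case ui: (nth false u i); case uj: (nth false u j) => /=.
- rewrite /shuffle ui uj ltn_add2l.
  by apply: (count_take_lt (x0 := false)); rewrite ?ui.
- apply/negbTE; rewrite -leqNgt ltnW //.
  exact: leq_trans (shuffle_small lt_ju uj) (shuffle_large ui).
- exact: leq_trans (shuffle_small lt_iu ui) (shuffle_large uj).
- rewrite /shuffle ui uj.
  by apply: (count_take_lt (x0 := false)); rewrite ?ui.
Qed.

Lemma shuffle_gt (u : seq bool) (i j : nat) : i < j -> j < size u ->
  (shuffle u j < shuffle u i) = nth false u i && ~~ nth false u j.
Proof.
move=> lt_ij lt_ju; have := shuffle_lt lt_ij lt_ju.
rewrite -negb_imply.
case: (ltngtP (shuffle u i) (shuffle u j)) => [_ <- //|_ <- //|eq_ij].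
have lt_iu := ltn_trans lt_ij lt_ju.
case ui: (nth false u i); case uj: (nth false u j) => //= _.
have := leq_trans (shuffle_small lt_ju uj) (shuffle_large ui).
by rewrite eq_ij ltnn.
Qed.

Lemma shuffle_inj (u : seq bool) (i j : nat) :
  i < size u -> j < size u -> shuffle u i = shuffle u j -> i = j.
Proof.
wlog lt_ij : i j / i < j => [IH iu ju eq_ij|].
  by case: (ltngtP i j) => // ?; [|apply/esym]; apply: IH.
move=> iu ju eq_ij; have := shuffle_lt lt_ij ju; have := shuffle_gt lt_ij ju.
rewrite eq_ij ltnn => /esym; case: (nth _ _ i); case: (nth _ _ j) => //.
Qed.

(** Picking the permutation makes the map total on words, as sums over [words n] require; when
    [size u = n] the default [1] is not reached. *)
Definition shuffle_perm (n : nat) (u : seq bool) : 'S_n :=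
  odflt 1%g [pick s : 'S_n | [forall i, s i == shuffle u i :> nat]].

Lemma shuffle_permE (n : nat) (u : seq bool) (i : 'I_n) :
  size u = n -> shuffle_perm n u i = shuffle u i :> nat.
Proof.
move=> size_u; rewrite /shuffle_perm; case: pickP => [s /forallP/(_ i)/eqP //|].
have bound (j : 'I_n) : shuffle u j < n
    by have := @shuffle_bound u j; rewrite size_u; apply.
have f_inj : injective (fun j => Ordinal (bound j)).
  move=> j k [eq_jk]; apply: val_inj.
  by apply: shuffle_inj eq_jk; rewrite size_u.
by move/(_ (perm f_inj))/negP => []; apply/forallP => j; rewrite permE.
Qed.

(** The default [true] rejects a first large letter in last position, which no small letter
    follows. *)
Lemma fishburn_wordP (u : seq bool) :
  reflect (forall j, nth false u j -> ~~ has id (take j u) ->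
             ~~ nth true u j.+1)
          (fishburn_word u).
Proof.
elim: u => [|[] u IH] /=; first by apply: ReflectT => -[].
  apply: (iffP idP) => [hu [|j] //= _ _|/(_ 0)].
  by rewrite -nth0; apply.
apply: (iffP IH) => hu j; last by move=> uj hj; apply: (hu j.+1).
by case: j => //= j; apply: hu.
Qed.

Lemma first_large (u : seq bool) : has id u ->
  exists2 j, nth false u j & ~~ has id (take j u).
Proof.
elim: u => [|[] u IH] //=; first by exists 0.
by move=> /IH[j uj hj]; exists j.+1.
Qed.

Lemma fishburn_word_descent (u : seq bool) : fishburn_word u -> has id u ->
  exists2 j, nth false u j & (j.+1 < size u) && ~~ nth false u j.+1.
Proof.
move=> /fishburn_wordP u_fish /first_large[j uj hj]; exists j => //.
have := u_fish j uj hj; case: (ltnP j.+1 (size u)) => [lt_ju|le_uj].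
  by rewrite (set_nth_default false).
by rewrite nth_default.
Qed.

Lemma has_id_nthP (u : seq bool) (i : nat) :
  reflect (exists2 j, j < i & nth false u j) (has id (take i u)).
Proof.
apply: (iffP hasP) => [[b /(nthP false)[j]]|[j lt_ji uj]].
  rewrite size_take_min leq_min => /andP[lt_ji _]; rewrite nth_take // => <-.
  by exists j.
have lt_ju : j < size u
  by rewrite ltnNge; apply/negP => ?; rewrite nth_default in uj.
exists true => //; apply/(nthP false); exists j; last by rewrite nth_take.
by rewrite size_take_min leq_min lt_ji.
Qed.

(** * Patterns, the Fishburn condition and descents of the inverse *)

Lemma contains_321P (n : nat) (s : 'S_n) :
  reflect (exists i j k : 'I_n, [/\ i < j, j < k, s k < s j & s j < s i])
          (contains [:: 3; 2; 1] s).
Proof.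
apply: (iffP existsP) => [[f /forallP f_pat]|[a [b [c [ab bc sc sb]]]]].
  pose i (k : nat) (lt_k : k < 3) : 'I_3 := Ordinal lt_k.
  exists (f (i 0 isT)), (f (i 1 isT)), (f (i 2 isT)).
  have /forallP f0 := f_pat (i 0 isT); have /forallP f1 := f_pat (i 1 isT).
  have /forallP f2 := f_pat (i 2 isT).
  have /= /andP[f01 _] := f0 (i 1 isT); have /= /andP[f12 _] := f1 (i 2 isT).
  have /= /eqP f10 := f1 (i 0 isT).
  have /= /eqP f21 := f2 (i 1 isT).
  by split; rewrite ?f01 ?f12 -?f10 -?f21.
exists [ffun i : 'I_3 => nth a [:: a; b; c] i].
apply/forallP => -[[|[|[|//]]] i_lt]; apply/forallP => -[[|[|[|//]]] j_lt];
  rewrite !ffunE /=; lia.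
Qed.

Lemma contains_2143P (n : nat) (s : 'S_n) :
  reflect (exists i j k l : 'I_n, [/\ i < j, j < k, k < l &
             [/\ s j < s i, s i < s l & s l < s k]])
          (contains [:: 2; 1; 4; 3] s).
Proof.
apply: (iffP existsP) =>
  [[f /forallP f_pat]|[a [b [c [d [ab bc cd [sb sa sd]]]]]]].
  pose i (k : nat) (lt_k : k < 4) : 'I_4 := Ordinal lt_k.
  exists (f (i 0 isT)), (f (i 1 isT)), (f (i 2 isT)), (f (i 3 isT)).
  have /forallP f0 := f_pat (i 0 isT); have /forallP f1 := f_pat (i 1 isT).
  have /forallP f2 := f_pat (i 2 isT); have /forallP f3 := f_pat (i 3 isT).
  have /= /andP[f01 _] := f0 (i 1 isT); have /= /andP[f12 _] := f1 (i 2 isT).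
  have /= /andP[f23 _] := f2 (i 3 isT).
  have /= /eqP f10 := f1 (i 0 isT).
  have /= /andP[_ /eqP f03] := f0 (i 3 isT).
  have /= /eqP f32 := f3 (i 2 isT).
  by split; rewrite ?f01 ?f12 ?f23; split; rewrite -?f10 -?f03 -?f32.
exists [ffun i : 'I_4 => nth a [:: a; b; c; d] i].
apply/forallP => -[[|[|[|[|//]]]] i_lt];
  apply/forallP => -[[|[|[|[|//]]]] j_lt]; rewrite !ffunE /=; lia.
Qed.

Lemma fishburnP (n : nat) (s : 'S_n) :
  reflect (forall j j1 k : 'I_n, j1 = j.+1 :> nat -> j1 < k ->
             s j = (s k).+1 :> nat -> s j1 <= s j)
          (fishburn s).
Proof.
apply: (iffP idP) => [s_fish j j1 k j1E lt_k sjE|s_fish].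
  rewrite leqNgt; apply: contra s_fish => lt_s.
  apply/'exists_'exists_existsP; exists j, j1, k.
  by rewrite lt_k lt_s j1E sjE !eqxx.
apply/existsP => -[j /existsP[j1 /existsP[k /and4P[/eqP j1E lt_k /eqP sjE]]]].
by rewrite ltnNge (s_fish _ _ _ j1E lt_k sjE).
Qed.

Lemma mem_F (n : nat) (s : 'S_n) :
  (s \in F n) = [&& fishburn s, avoids [:: 3; 2; 1] s
                  & avoids [:: 2; 1; 4; 3] s].
Proof. by rewrite inE. Qed.

Lemma perm_neq (n : nat) (s : 'S_n) (i j : 'I_n) : i != j -> s i != s j :> nat.
Proof. by move=> ij; rewrite val_eqE (inj_eq perm_inj). Qed.

(* Two descents of the inverse, at the values s b = s a + 1 < s d = s c + 1,
   could only be arranged as b < d < a < c, and the entry right after b then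
   either breaks the Fishburn condition or plays the role of 1 in a 2143. *)
Lemma inverse_descent_unique (n : nat) (s : 'S_n) (a b c d : 'I_n) :
  s \in F n -> b < a -> s b = (s a).+1 :> nat -> d < c ->
  s d = (s c).+1 :> nat -> b = d.
Proof.
rewrite mem_F.
move=> /and3P[/fishburnP s_fish /contains_321P s321 /contains_2143P s2143].
have no321 (i j k : 'I_n) : i < j -> j < k -> s k < s j -> s j < s i -> False.
  by move=> *; apply: s321; exists i, j, k.
have no2143 (i j k l : 'I_n) : i < j -> j < k -> k < l ->
    s j < s i -> s i < s l -> s l < s k -> False.
  by move=> *; apply: s2143; exists i, j, k, l.
have neq (i j : 'I_n) : s i != s j :> nat -> i != j :> nat.
  by apply: contra => /eqP/val_inj ->.
wlog lt_sad : a b c d / s a < s c => [IH ba sb dc sd|].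
  case: (ltngtP (s a) (s c)) => [lt|lt|eq_ac]; first exact: (IH a b c d).
    by apply/esym; apply: (IH c d a b).
  by apply/(@perm_inj _ s)/val_inj; rewrite /= sb sd eq_ac.
move=> ba sb dc sd; exfalso.
have [sbc|sbc|/val_inj sbc] := ltngtP (s b) (s c); [|lia|]; last first.
  (* If the two descents share a value, then [d], [c = b], [a] carry a 321. *)
  have cb : c = b by apply: (@perm_inj _ s).
  by apply: (no321 d c a); rewrite // ?sd // cb.
have neq_ad : a != d :> nat by apply: neq; lia.
have neq_ac : a != c :> nat by apply: neq; lia.
have neq_bd : b != d :> nat by apply: neq; lia.
(* The other relative orders are excluded in turn, each by a 2143 or a 321. *)
have [lt_ad|le_da] := ltnP a d; first by apply: (no2143 b a d c); lia.
have [lt_ca|le_ac] := ltnP c a; first by apply: (no321 d c a); lia.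
have [lt_db|le_bd] := ltnP d b; first by apply: (no321 d b a); lia.
have x_lt : b.+1 < n by apply: leq_ltn_trans (ltn_ord d); lia.
pose x := Ordinal x_lt.
have xE : x = b.+1 :> nat by [].
have sxb : s x <= s b by apply: (s_fish b x a) => //; rewrite xE; lia.
have neq_bx : s b != s x :> nat by apply: perm_neq; rewrite -val_eqE /=; lia.
have neq_xd : x != d :> nat by apply: neq; lia.
by apply: (no2143 b x d c); lia.
Qed.

(** * The bijection between Fishburn words and [F n] *)

Lemma card_perm_lt (n : nat) (s : 'S_n) (i : 'I_n) :
  #|[set j | s j < s i]| = s i.
Proof.
have -> : [set j | s j < s i] = s @^-1: [set v : 'I_n | v < s i].
  by apply/setP => j; rewrite !inE.
rewrite card_preimset; last exact: perm_inj.
have w_inj : injective (widen_ord (ltnW (ltn_ord (s i)))).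
  by move=> v w [eq_vw]; apply: val_inj.
rewrite -[RHS]card_ord -(card_imset _ w_inj).
apply: eq_card => v; rewrite inE.
apply/idP/imsetP => [lt_v|[w _ ->]]; last exact: (ltn_ord w).
by exists (Ordinal lt_v) => //; apply: val_inj.
Qed.

(** An entry is the number of smaller entries, so the comparisons determine it. *)
Lemma perm_order_inj (n : nat) (s s' : 'S_n) :
  (forall i j : 'I_n, i < j -> (s i < s j) = (s' i < s' j)) -> s = s'.
Proof.
move=> eq_lt; apply/permP => i; apply/val_inj.
rewrite /= -(card_perm_lt s) -(card_perm_lt s').
apply: eq_card => j; rewrite !inE.
case: (ltngtP i j) => [ij|ji|/val_inj ->]; rewrite ?ltnn //; last exact: eq_lt.
have neq_ij : i != j by rewrite -val_eqE /= neq_ltn ij.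
have := perm_neq s neq_ij; have := perm_neq s' neq_ij; have := eq_lt i j ij.
case: (ltngtP (s i) (s j)); case: (ltngtP (s' i) (s' j)) => //.
Qed.

(** The threshold [m] between small and large values is the upper value of the only descent of the
    inverse, or [n] if there is none; on each side of it the values occur in increasing order. *)
Lemma F_shuffle (n : nat) (s : 'S_n) : s \in F n ->
  exists2 u, (size u == n) && fishburn_word u & s = shuffle_perm n u.
Proof.
move=> sF.
have [m [m_mono m_desc]] : exists m : nat,
  (forall i j : 'I_n, s i < s j -> (s j < m) || (m <= s i) -> i < j) /\
  (m < n -> exists b a : 'I_n,
     [/\ b < a, s b = (s a).+1 :> nat & s b = m :> nat]).
  (* Two values on the same side of [m] are joined by consecutive values none of which is a descent
     of the inverse; the induction is on their difference. *)
  have step m :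
      (forall b a : 'I_n, b < a -> s b = (s a).+1 :> nat -> s b = m :> nat) ->
      forall i j : 'I_n, s i < s j -> (s j < m) || (m <= s i) -> i < j.
    move=> desc i j /subnKC; move: (_ - _) => d; elim: d j => [|d IH] j.
      rewrite addn0 => sj m_ij; case: (ltngtP i j) => // [lt_ji|/val_inj eq_ij].
        by have := desc _ _ lt_ji (esym sj); lia.
      by move: sj; rewrite eq_ij; lia.
    move=> sj m_ij.
    have lt_n : (s j).-1 < n by apply: leq_ltn_trans (leq_pred _) (ltn_ord _).
    pose j' := (s^-1)%g (Ordinal lt_n).
    have sj' : s j' = (s j).-1 :> nat by rewrite permKV.
    have lt_ij' : i < j' by apply: IH; lia.
    apply: ltn_trans lt_ij' _.
    case: (ltngtP j' j) => // [lt_jj'|/val_inj eq_jj'].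
      by have := desc _ _ lt_jj'; lia.
    by move: sj'; rewrite eq_jj'; lia.
  case: (pickP (fun ba : 'I_n * 'I_n =>
    (ba.1 < ba.2) && (s ba.1 == (s ba.2).+1 :> nat))).
    move=> [b a] /= /andP[ba /eqP sb]; exists (s b); split; last by exists b, a.
    apply: step => d c dc sd.
    by rewrite (inverse_descent_unique sF ba sb dc sd).
  move=> no_desc; exists n; split; last by rewrite ltnn.
  by apply: step => b a ba sb; have := no_desc (b, a); rewrite /= ba sb eqxx.
pose u := [seq m <= s i | i <- enum 'I_n].
have size_u : size u = n by rewrite size_map size_enum_ord.
have uE x0 (i : 'I_n) : nth x0 u i = (m <= s i).
  by rewrite (nth_map i) ?size_enum_ord // nth_ord_enum.
exists u.
  rewrite size_u eqxx; apply/fishburn_wordP => j uj hj.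
  have lt_jn : j < n
    by rewrite -size_u ltnNge; apply/negP => ?; rewrite nth_default in uj.
  move: uj; rewrite (uE false (Ordinal lt_jn)); set i := Ordinal lt_jn => m_si.
  have [b [a [ba sb sbm]]] := m_desc (leq_ltn_trans m_si (ltn_ord _)).
  (* The position [b] carries [m], the least large value, so it is the first large position. *)
  have bi : b = i.
    apply/val_inj/eqP; rewrite /= eqn_leq; apply/andP; split.
      have [->//|neq_bi] := eqVneq b i.
      suff : b < i by apply: ltnW.
      apply: m_mono; rewrite ?sbm ?leqnn ?orbT //.
      by have := perm_neq s neq_bi; lia.
    rewrite leqNgt; apply/negP => lt_bj; move/has_id_nthP: hj; apply.
    by exists b => //; rewrite uE sbm.
  have bj : b = j :> nat by rewrite bi.
  have lt_j1 : j.+1 < n by rewrite -bj; apply: leq_ltn_trans (ltn_ord a).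
  rewrite (uE true (Ordinal lt_j1)) -ltnNge; set j1 := Ordinal lt_j1.
  have [j1a|neq_j1a] := eqVneq j1 a; first by rewrite j1a; lia.
  (* The Fishburn condition at [b], [j1], [a] then puts the entry at [j1] below [s b = m]. *)
  have lt_j1a : j1 < a by move: neq_j1a; rewrite -val_eqE /=; lia.
  move: sF; rewrite mem_F => /andP[/fishburnP s_fish _].
  have j1b : j1 = b.+1 :> nat by rewrite /= bj.
  have := s_fish b j1 a j1b lt_j1a sb.
  have : s b != s j1 :> nat by apply: perm_neq; rewrite -val_eqE /=; lia.
  lia.
apply: perm_order_inj => i j ij.
rewrite !shuffle_permE // shuffle_lt ?size_u //.
rewrite !uE; have neq_ij : i != j by rewrite -val_eqE /= neq_ltn ij.
have := perm_neq s neq_ij; have := m_mono i j; have := m_mono j i.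
lia.
Qed.

(** The middle entry of a 321 would be both small and large. In a 2143 the 2 would be large and the
    3 small, although 2 < 3. *)
Lemma shuffle_perm_F (n : nat) (u : seq bool) :
  size u = n -> fishburn_word u -> shuffle_perm n u \in F n.
Proof.
move=> size_u u_fish; set s := shuffle_perm n u.
have s_lt (i j : 'I_n) : i < j ->
    (s i < s j) = (nth false u i ==> nth false u j).
  by move=> ij; rewrite !shuffle_permE // shuffle_lt // size_u.
have s_gt (i j : 'I_n) : i < j ->
    (s j < s i) = nth false u i && ~~ nth false u j.
  by move=> ij; rewrite !shuffle_permE // shuffle_gt // size_u.
rewrite mem_F; apply/and3P; split.
- apply/fishburnP => j j1 k j1E lt_j1k sj.
  have lt_jk : j < k by rewrite -j1E in lt_j1k *; lia.
  have := s_gt j k lt_jk; rewrite {1}sj ltnSn => /esym/andP[uj uk].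
  (* An earlier large entry would lie strictly between the consecutive values [s k] and [s j]. *)
  have no_large : ~~ has id (take j u).
    apply/negP => /has_id_nthP[i lt_ij ui].
    pose i' := Ordinal (ltn_trans lt_ij (ltn_ord j)).
    have := s_lt i' j lt_ij; have := s_gt i' k (ltn_trans lt_ij lt_jk).
    by rewrite /= ui uk uj sj; lia.
  have lt_j1 : j.+1 < size u by rewrite size_u -j1E.
  have /fishburn_wordP/(_ j uj no_large) := u_fish.
  rewrite (set_nth_default false) // => uj1.
  have lt_jj1 : j < j1 by rewrite j1E.
  by have := s_gt j j1 lt_jj1; rewrite uj j1E uj1 sj => /ltnW.
- apply/contains_321P => -[i [j [k [ij jk]]]].
  by rewrite (s_gt _ _ ij) (s_gt _ _ jk) => /andP[-> _]; rewrite andbF.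
- apply/contains_2143P => -[i [j [k [l [ij jk kl [+ + +]]]]]].
  rewrite (s_gt _ _ ij) (s_lt _ _ (ltn_trans ij (ltn_trans jk kl))).
  by rewrite (s_gt _ _ kl) => /andP[-> _] /= ->; rewrite andbF.
Qed.

Lemma shuffle_ge (u : seq bool) (i : nat) :
  i < size u -> (count negb u <= shuffle u i) = nth false u i.
Proof.
move=> lt_iu; case ui: (nth false u i); first exact: shuffle_large.
by apply/negbTE; rewrite -ltnNge shuffle_small.
Qed.

Lemma shuffle_consF (u : seq bool) (i : nat) :
  shuffle (false :: u) i.+1 = (shuffle u i).+1.
Proof. by rewrite /shuffle /=; case: ifP. Qed.

(** The first entry is 0 exactly if the first letter is small, because a large first letter has a
    small one after it. If both first letters are large, their common entry is the number of small
    letters, and this threshold determines all letters. *)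
Lemma shuffle_word_inj (u v : seq bool) :
  fishburn_word u -> fishburn_word v -> size u = size v ->
  (forall i, i < size u -> shuffle u i = shuffle v i) -> u = v.
Proof.
elim: u v => [|b u IH] [|c v] // u_fish v_fish [size_uv] eq_uv.
have pos w : fishburn_word (true :: w) -> 0 < shuffle (true :: w) 0.
  by case: w => [|[] w].
have small_eq : count negb (b :: u) = count negb (c :: v) -> b :: u = c :: v.
  move=> eq_count; apply: (@eq_from_nth _ false) => [|i lt_i].
    by rewrite /= size_uv.
  by rewrite -!shuffle_ge ?eq_uv ?eq_count // -?size_uv //= -size_uv.
case: b c u_fish v_fish eq_uv small_eq => [] [] u_fish v_fish eq_uv small_eq.
- by apply: small_eq; have := eq_uv 0 isT; rewrite /shuffle /= !addn0.
- by have := pos _ u_fish; rewrite eq_uv.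
- by have := pos _ v_fish; rewrite -eq_uv.
congr (_ :: _); apply: IH => // i lt_i; apply: succn_inj.
by rewrite -!shuffle_consF eq_uv.
Qed.

(** Surjectivity of [shuffle_perm] onto [F n] is [F_shuffle], and injectivity is
    [shuffle_word_inj]. *)
Lemma big_F (R : nmodType) (n : nat) (P : pred 'S_n) (g : 'S_n -> R) :
  (\sum_(s in F n | P s) g s =
   \sum_(u <- words n | fishburn_word u && P (shuffle_perm n u))
     g (shuffle_perm n u))%R.
Proof.
have perm_F : perm_eq (enum (F n))
    [seq shuffle_perm n u | u <- words n & fishburn_word u].
  apply: uniq_perm; first exact: enum_uniq.
    rewrite map_inj_in_uniq ?filter_uniq ?words_uniq // => u v.
    rewrite !mem_filter !mem_words => /andP[u_fish /eqP size_u].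
    move=> /andP[v_fish /eqP size_v] eq_uv.
    apply: shuffle_word_inj => // [|i]; first by rewrite size_u.
    rewrite size_u => lt_in.
    by rewrite -!(@shuffle_permE n _ (Ordinal lt_in)) ?eq_uv.
  move=> s; rewrite mem_enum; apply/idP/mapP => [/F_shuffle[u]|[u]].
    move=> /andP[size_u u_fish] ->; exists u => //.
    by rewrite mem_filter u_fish mem_words.
  rewrite mem_filter mem_words => /andP[u_fish /eqP size_u] ->.
  exact: shuffle_perm_F.
rewrite big_mkcondr -[LHS]big_enum /= (perm_big _ perm_F) big_map.
by rewrite big_filter -big_mkcondr.
Qed.

(** * Left-to-right maxima and labels read off the word *)

Lemma lrmax_shuffle (n : nat) (u : seq bool) :
  size u = n -> lrmax (shuffle_perm n u) = word_lrmax u.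
Proof.
move=> size_u; rewrite /lrmax -sum1dep_card big_mkcond /=.
transitivity (\sum_(i < n) (nth false u i || ~~ has id (take i u) : nat)).
  apply: eq_bigr => i _; rewrite -[if _ then _ else _]/(nat_of_bool _).
  congr nat_of_bool; apply/forallP/idP => [i_max|ui j]; last first.
    apply/implyP => ji; rewrite !shuffle_permE // shuffle_lt ?size_u //.
    apply/implyP => uj; case/orP: ui => // /has_id_nthP[]; by exists j.
  case ui: (nth false u i) => //=; apply/has_id_nthP => -[j ji uj].
  have := i_max (Ordinal (ltn_trans ji (ltn_ord i))).
  by rewrite ji !shuffle_permE // shuffle_lt ?size_u //= uj ui.
elim: u n size_u => [|b u IH] n <- /=; first by rewrite big_ord0.
rewrite big_ord_recl /= orbT add1n; congr _.+1.
case: b => /=; last exact: IH.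
elim: u {IH} => [|c u IH] /=; first by rewrite big_ord0.
by rewrite big_ord_recl /= orbF -IH; congr (_ + _); apply: eq_bigr.
Qed.

Lemma oneline_shuffle (n : nat) (u : seq bool) : size u = n ->
  oneline (shuffle_perm n u) = [seq (shuffle u i).+1 | i <- iota 0 n].
Proof.
move=> size_u; rewrite -val_enum_ord -map_comp; apply: eq_map => i /=.
by rewrite shuffle_permE.
Qed.

Lemma label_1a_shuffle (n : nat) (u : seq bool) :
  0 < n -> size u = n -> fishburn_word u ->
  label_1a (shuffle_perm n u) = word_1a u.
Proof.
case: n => // n _ size_u u_fish.
have -> : word_1a u = nth false u n.
  rewrite /word_1a suffixE size_u subSS subn0 (drop_nth false) ?size_u //.
  by rewrite drop_oversize ?size_u // eqseq_cons andbT eqb_id.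
rewrite /label_1a oneline_shuffle // -nth_last size_map size_iota -pred_Sn.
rewrite (nth_map 0) ?size_iota // nth_iota // add0n eqSS.
case un: (nth false u n).
  have count_un : count id u = (count id (take n u)).+1.
    rewrite -[in LHS](cat_take_drop n u) count_cat (drop_nth false) ?size_u //.
    by rewrite drop_oversize ?size_u //= un addn1.
  have -> : shuffle u n == n.
    rewrite /shuffle un -(eqn_add2r 1) -addnA addn1 -count_un count_negb_id.
    by rewrite size_u addn1.
  have has_u : has id u.
    rewrite -[u]take_size size_u; apply/has_id_nthP; by exists n.
  have [j uj /andP[lt_j uj1]] := fishburn_word_descent u_fish has_u.
  rewrite size_u in lt_j.
  apply/existsP; exists (Ordinal (ltnW lt_j)).
  apply/existsP; exists (Ordinal lt_j); rewrite eqxx /= !shuffle_permE //=.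
  by rewrite shuffle_gt ?size_u ?uj.
(* The top of a descent is large, so it exceeds a small last entry, which cannot be the maximum. *)
apply/negP => /andP[/eqP un_max /existsP[i /existsP[j /andP[/eqP ji]]]].
have lt_in : i < n by have := ltn_ord j; rewrite ji.
rewrite !shuffle_permE // shuffle_gt ?size_u ?ji // => /andP[ui _].
have := @shuffle_gt u i n lt_in; rewrite size_u ui un un_max => /(_ (ltnSn n)).
by have := @shuffle_bound u i; rewrite size_u; lia.
Qed.

(** The last large letter carries the maximum, and the small letters after it continue the numbering
    of those before it. *)
Lemma oneline_shuffle_suffix (p c : nat) (u : seq bool) :
  size u = p + c.+1 -> drop p u = true :: nseq c false ->
  drop p (oneline (shuffle_perm (p + c.+1) u)) =
    p + c.+1 :: iota (count negb (take p u)).+1 c.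
Proof.
move=> size_u u_drop.
have size_take_u : size (take p u) = p by rewrite size_takel // size_u leq_addr.
have uE : u = take p u ++ true :: nseq c false by rewrite -u_drop cat_take_drop.
have up : nth false u p by rewrite -[p]addn0 -nth_drop u_drop.
rewrite oneline_shuffle // -map_drop drop_iota add0n addKn /=; congr (_ :: _).
  rewrite /shuffle up {1}uE count_cat /= count_nseq mul1n add0n.
  by rewrite addnAC count_negb_id size_take_u addnS.
apply: (@eq_from_nth _ 0) => [|i]; rewrite size_map !size_iota // => lt_ic.
rewrite (nth_map 0) ?size_iota // !nth_iota // addSnnS addSn; congr _.+1.
rewrite /shuffle -nth_drop u_drop /= nth_nseq if_same.
rewrite [in take _ u]uE take_cat size_take_u ltnNge leq_addr /= addKn /=.
by rewrite count_cat /= take_nseq ?count_nseq ?mul1n ?add0n // ltnW.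
Qed.

(** The bound on [x] keeps the entries of [iota x c] below [p + c.+1], so each forms an inversion
    with position [p], and an inversion reveals both of its letters. *)
Lemma oneline_shuffle_suffixE (p c x : nat) (u : seq bool) :
  size u = p + c.+1 -> 0 < c -> x <= p.+1 ->
  (drop p (oneline (shuffle_perm (p + c.+1) u)) == p + c.+1 :: iota x c) =
  (drop p u == true :: nseq c false) && (x == (count negb (take p u)).+1).
Proof.
move=> size_u c_gt0 le_xp; apply/eqP/andP => [eq_drop|[/eqP u_drop /eqP ->]].
  suff u_drop : drop p u = true :: nseq c false.
    move: eq_drop; rewrite (oneline_shuffle_suffix size_u u_drop) u_drop eqxx.
    by case: (c) c_gt0 => // d _ [-> _].
  move: eq_drop; rewrite oneline_shuffle // -map_drop drop_iota add0n addKn /=.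
  move=> [up eq_iota].
  have gt_p i : i < c -> nth false u p && ~~ nth false u (p + i.+1).
    move=> lt_ic; rewrite -shuffle_gt ?size_u ?ltn_add2l //; last first.
      by rewrite addnS ltnS leq_addr.
    rewrite -ltnS up.
    have := congr1 (fun t => nth 0 t i) eq_iota.
    rewrite (nth_map 0) ?size_iota // !nth_iota // addSnnS => ->.
    lia.
  apply: (@eq_from_nth _ false);
    rewrite size_drop size_u addKn /= ?size_nseq //.
  move=> [|i] lt_i.
    by rewrite nth_drop addn0 /=; case/andP: (gt_p 0 c_gt0).
  rewrite nth_drop /= nth_nseq if_same.
  by case/andP: (gt_p i lt_i) => _ /negbTE.
exact: oneline_shuffle_suffix.
Qed.

Lemma fishburn_word_small (v w : seq bool) :
  fishburn_word (v ++ true :: w) -> has id v -> 0 < count negb v.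
Proof. by case: v => [|[] [|[] v]]. Qed.

Lemma label_star_shuffle (k n : nat) (u : seq bool) :
  1 < k -> size u = n -> fishburn_word u ->
  label_star k (shuffle_perm n u) = word_star k u.
Proof.
move=> k_gt1 size_u u_fish; rewrite /label_star (ltnW k_gt1) k_gt1 /=.
have [le_nk|lt_kn] := leqP n k.
  rewrite [RHS](negbTE (_ : ~~ _)); last first.
    apply/negP => /(word_star_size (ltnW k_gt1)).
    by rewrite size_u ltnNge le_nk.
  apply/negbTE/norP; split; last by apply/existsP => -[l]; lia.
  apply/eqP => /(congr1 size).
  by rewrite size_drop size_map size_enum_ord /= size_iota; lia.
rewrite /word_star !suffixE size_u /= !size_nseq; congr orb.
  have nE : n = (n - k.+1) + k.+1 by rewrite subnK.
  have := @oneline_shuffle_suffixE (n - k.+1) k (n - k) u.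
  rewrite -nE => -> //; [|lia|lia].
  (* The value [n - k] says that all [n - k.+1] letters before the suffix are small, so that there
     is only one large letter. *)
  case: eqP => //= u_drop.
  rewrite -[X in count id X](cat_take_drop (n - k.+1) u) count_cat u_drop.
  rewrite /= count_nseq /=.
  have := count_negb_id (take (n - k.+1) u).
  by rewrite size_takel ?size_u ?leq_subr //; lia.
have nE : n = (n - k) + k.-1.+1 by rewrite prednK ?subnK //; lia.
have k1 : k.-1.+1 = k by lia.
have := @oneline_shuffle_suffixE (n - k) k.-1 _ u; rewrite -nE k1 subn1.
move=> suffE.
have size_tk : size (take (n - k) u) = n - k.
  by rewrite size_takel // size_u leq_subr.
have cntE := count_negb_id (take (n - k) u).
apply/existsP/andP => [[l /and3P[kl ln]]|[/eqP u_drop]].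
  rewrite suffE //; [|lia|lia] => /andP[/eqP u_drop /eqP cnt]; split.
    by rewrite u_drop.
  rewrite -[X in count id X](cat_take_drop (n - k) u) count_cat u_drop.
  by rewrite /= count_nseq; lia.
rewrite -[X in count id X](cat_take_drop (n - k) u) count_cat u_drop.
rewrite /= count_nseq => count_gt1.
have cnt_gt0 : 0 < count negb (take (n - k) u).
  apply: (@fishburn_word_small _ (nseq k.-1 false)); last first.
    by rewrite has_count; lia.
  by rewrite -u_drop cat_take_drop.
(* The witness for l is the number of small letters of [u], which is the largest small entry. *)
have lt_l : count negb (take (n - k) u) + k.-1 < n by lia.
exists (Ordinal lt_l) => /=; apply/and3P; split; [lia|lia|].
by rewrite suffE ?u_drop ?eqxx /=; lia.
Qed.

(** * Generating functions at q = 1 *)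

Local Open Scope ring_scope.

(** Setting q = 1 removes the inversion factor. Labels and word predicates are compared on Fishburn
    words of length [n] only, where they correspond. *)
Lemma horner1_label_gf (n : nat) (y : pred 'S_n) (P : pred (seq bool)) :
  {in [pred u | fishburn_word u & size u == n],
    forall u, y (shuffle_perm n u) = P u} ->
  (label_gf y).[1] =
  \sum_(u <- words n | fishburn_word u && P u) 'X^(word_lrmax u).
Proof.
move=> yP; rewrite /label_gf big_F horner_sum big_seq_cond [RHS]big_seq_cond.
apply: eq_big => [u|u /andP[]]; rewrite mem_words; last first.
  move=> /eqP size_u _.
  by rewrite hornerM hornerXn expr1n mul1r hornerC lrmax_shuffle.
case u_fish: (fishburn_word u); rewrite ?andbF //=.
by case: eqP => //= size_u; rewrite yP // inE u_fish size_u /=.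
Qed.

Theorem proposition9p6 :
  (forall n : nat, (3 <= n)%N ->
     (label_gf (@label_1a n)).[1] = 'X^2 * ('X + 1) ^+ (n - 2) - 'X^n) /\
  (forall n k : nat, (3 <= n)%N -> (2 <= k)%N ->
     (label_gf (@label_star k n)).[1] =
       if (k < n)%N
       then 'X^2 * ('X + 1) ^+ (n - k - 1) - 'X^(n - k + 1) + 'X^(n - k)
       else 0) /\
  (forall n : nat, (1 <= n)%N -> (T n).[1] = 'X * ('X + 1) ^+ (n - 1)).
Proof.
split; [|split].
- move=> [|[|n]] // n_ge3; rewrite (horner1_label_gf (P := word_1a)) => [|u].
    by rewrite sum_word_1a subn2.
  by rewrite inE => /andP[u_fish /eqP size_u]; rewrite label_1a_shuffle.
- move=> n k n_ge3 k_ge2.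
  rewrite (horner1_label_gf (P := word_star k)) => [|u]; last first.
    by rewrite inE => /andP[u_fish /eqP size_u]; rewrite label_star_shuffle.
  case: ltnP => [lt_kn|le_nk]; last by rewrite sum_word_star_small // ltnW.
  case: k k_ge2 lt_kn => [|[|k]] // _ lt_kn.
  have [p ->] : exists p, n = (p + k.+2).+1 by exists (n - k.+3)%N; lia.
  by rewrite sum_word_star -addSn addnK subn1 addn1.
- move=> [|n] // _; rewrite subn1 /= -sum_word_all.
  have -> : T n.+1 = label_gf (@predT 'S_n.+1).
    by apply: eq_bigl => s; rewrite andbT.
  rewrite (horner1_label_gf (P := predT)) //.
  by apply: eq_bigl => u; rewrite andbT.
Qed.
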